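(* Let $\mathbf A\in\mathbb H^{n\times n}$ be diagonalizable. Then the right system $\mathbf x'=\mathbf A\mathbf x$ has the general solution $$\mathbf x_{gen}(t)=\mathbf v_1e^{\lambda_1t}q_1+\dots+\mathbf v_ne^{\lambda_nt}q_n,$$ where $\{\mathbf v_1,\dots,\mathbf v_n\}$ is a set of right linearly independent column eigenvectors of $\mathbf A$ with corresponding eigenvalues $\lambda_1,\dots,\lambda_n$, and $q_1,\dots,q_n\in\mathbb H$ are arbitrary constants. Furthermore, every initial value problem $\mathbf x'=\mathbf A\mathbf x$, $\mathbf x(t_0)=\mathbf x_0$ ($t_0\in\mathbb R$) has a unique solution for every initial condition $\mathbf x_0\in\mathbb H^{n\times1}$, where the constants $q_1,\dots,q_n$ are a solution of the algebraic linear system $$\mathbf x_0=\mathbf v_1e^{\lambda_1t_0}q_1+\dots+\mathbf v_ne^{\lambda_nt_0}q_n,$$ and this solution is given by $$\mathbf x(t)=\mathbf X_r(t)\mathbf X_r^{-1}(t_0)\mathbf x_0,$$ where $\mathbf X_r(t)=[\mathbf v_1e^{\lambda_1t},\dots,\mathbf v_ne^{\lambda_nt}]$ is a fundamental matrix of the system.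
   Context: $\mathbb H$ is the real quaternion skew field; derivatives in the real variable $t$ are componentwise; $e^{q}=\sum_{m\ge0}q^m/m!$ for $q\in\mathbb H$. $\mathbf A$ is diagonalizable if $\mathbf A=\mathbf P\mathbf D\mathbf P^{-1}$ for some invertible $\mathbf P$ and diagonal $\mathbf D$ in $\mathbb H^{n\times n}$. An eigenvalue of $\mathbf A$ means a right eigenvalue: $\lambda\in\mathbb H$ with $\mathbf A\mathbf v=\mathbf v\lambda$ for some nonzero column $\mathbf v$, called a corresponding eigenvector. (The eigenvalues may be chosen to be complex numbers.) Column vectors form a right $\mathbb H$-vector space. A fundamental matrix of $\mathbf x'=\mathbf A\mathbf x$ is a matrix whose columns are right linearly independent solutions (no constants $q_i\in\mathbb H$, not all zero, satisfy $\sum_i\mathbf x_i(t)q_i=\mathbf 0$ for all $t$); ''general solution'' means that the functions of the given form, as the constants $q_i$ range over $\mathbb H$, are exactly the solutions. *)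

(* Defs.v *)
From HB Require Import structures.
From mathcomp Require Import all_boot all_order all_algebra.
From mathcomp Require Import all_classical all_reals all_analysis.
From mathcomp Require Import ring lra.
Set Implicit Arguments.
Unset Strict Implicit.
Unset Printing Implicit Defensive.
Import Order.TTheory GRing.Theory Num.Theory.
Import numFieldNormedType.Exports.
Local Open Scope classical_set_scope.
Local Open Scope ring_scope.

(* Quat a b c d stands for a + b i + c j + d k. *)
Record quat (R : Type) : Type := Quat { qre : R; qim : R; qjm : R; qkm : R }.

Section QuatAlgebra.
Variable R : realType.
Local Notation H := (quat R).

Definition quat_tuple (q : H) : R * R * R * R := (qre q, qim q, qjm q, qkm q).
Definition tuple_quat (u : R * R * R * R) : H :=
  let: (a, b, c, d) := u in Quat a b c d.
Lemma quat_tupleK : cancel quat_tuple tuple_quat. Proof. by case. Qed.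

HB.instance Definition _ := Choice.copy H (can_type quat_tupleK).

Definition qadd (p q : H) : H :=
  Quat (qre p + qre q) (qim p + qim q) (qjm p + qjm q) (qkm p + qkm q).
Definition qopp (p : H) : H := Quat (- qre p) (- qim p) (- qjm p) (- qkm p).
Definition qscale (a : R) (p : H) : H :=
  Quat (a * qre p) (a * qim p) (a * qjm p) (a * qkm p).
(* Hamilton's rule i^2 = j^2 = k^2 = ijk = -1 *)
Definition qmul (p q : H) : H :=
  Quat (qre p * qre q - qim p * qim q - qjm p * qjm q - qkm p * qkm q)
       (qre p * qim q + qim p * qre q + qjm p * qkm q - qkm p * qjm q)
       (qre p * qjm q - qim p * qkm q + qjm p * qre q + qkm p * qim q)
       (qre p * qkm q + qim p * qjm q - qjm p * qim q + qkm p * qre q).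
Definition qsqnorm (p : H) : R :=
  qre p ^+ 2 + qim p ^+ 2 + qjm p ^+ 2 + qkm p ^+ 2.
Definition qinv (p : H) : H :=
  qscale (qsqnorm p)^-1 (Quat (qre p) (- qim p) (- qjm p) (- qkm p)).

Local Ltac quat_ring :=
  repeat case=> ? ? ? ?; rewrite /qadd /qopp /qmul /qscale /=; congr Quat; ring.

Lemma qaddA : associative qadd. Proof. quat_ring. Qed.
Lemma qaddC : commutative qadd. Proof. quat_ring. Qed.
Lemma qadd0 : left_id (Quat 0 0 0 0 : H) qadd. Proof. quat_ring. Qed.
Lemma qaddN : left_inverse (Quat 0 0 0 0 : H) qopp qadd.
Proof. quat_ring. Qed.
HB.instance Definition _ := GRing.isZmodule.Build H qaddA qaddC qadd0 qaddN.

Lemma qmulA : associative qmul. Proof. quat_ring. Qed.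
Lemma qmul1l : left_id (Quat 1 0 0 0 : H) qmul. Proof. quat_ring. Qed.
Lemma qmul1r : right_id (Quat 1 0 0 0 : H) qmul. Proof. quat_ring. Qed.
Lemma qmulDl : left_distributive qmul +%R.
Proof. move=> p q r; change (qmul (qadd p q) r = qadd (qmul p r) (qmul q r)).
by move: p q r; quat_ring. Qed.
Lemma qmulDr : right_distributive qmul +%R.
Proof. move=> p q r; change (qmul p (qadd q r) = qadd (qmul p q) (qmul p r)).
by move: p q r; quat_ring. Qed.
Lemma qone_neq0 : (Quat 1 0 0 0 : H) != 0.
Proof. by apply/eqP => -[/eqP]; rewrite oner_eq0. Qed.
HB.instance Definition _ :=
  GRing.Zmodule_isNzRing.Build H qmulA qmul1l qmul1r qmulDl qmulDr qone_neq0.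

Lemma qscaleA a b (p : H) : qscale a (qscale b p) = qscale (a * b) p.
Proof. by move: p; quat_ring. Qed.
Lemma qscale1 : left_id 1 qscale.
Proof. quat_ring. Qed.
Lemma qscaleDr : right_distributive qscale +%R.
Proof. move=> a p q; change (qscale a (qadd p q) = qadd (qscale a p) (qscale a q)).
by move: p q; quat_ring. Qed.
Lemma qscaleDl (p : H) : {morph qscale^~ p : a b / a + b}.
Proof. move=> a b; change (qscale (a + b) p = qadd (qscale a p) (qscale b p)).
by move: p; quat_ring. Qed.
HB.instance Definition _ :=
  GRing.Zmodule_isLmodule.Build R H qscaleA qscale1 qscaleDr qscaleDl.

Lemma qscaleAl (a : R) (p q : H) : a *: (p * q) = (a *: p) * q.
Proof. change (qscale a (qmul p q) = qmul (qscale a p) q).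
by move: p q; quat_ring. Qed.
HB.instance Definition _ := GRing.Lmodule_isLalgebra.Build R H qscaleAl.
Lemma qscaleAr (a : R) (p q : H) : a *: (p * q) = p * (a *: q).
Proof. change (qscale a (qmul p q) = qmul p (qscale a q)).
by move: p q; quat_ring. Qed.
HB.instance Definition _ := GRing.Lalgebra_isAlgebra.Build R H qscaleAr.

Lemma qsqnorm_eq0 (p : H) : (qsqnorm p == 0) = (p == 0).
Proof.
case: p => a b c d; apply/eqP/eqP => [|[-> -> -> ->]]; last first.
  by rewrite /qsqnorm /= expr0n /= !addr0.
rewrite /qsqnorm /= => /eqP.
rewrite !paddr_eq0 ?addr_ge0 ?sqr_ge0// !sqrf_eq0.
by move=> /andP[/andP[/andP[/eqP-> /eqP->] /eqP->] /eqP->].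
Qed.

Definition qunit : pred H := fun p => p != 0.
Lemma qmulVl : {in qunit, left_inverse 1 qinv *%R}.
Proof.
move=> p; rewrite unfold_in /= /qunit -qsqnorm_eq0 => p0.
case: p p0 => a b c d; rewrite /qsqnorm /= => p0.
change (qmul (qinv (Quat a b c d)) (Quat a b c d) = Quat 1 0 0 0).
by rewrite /qinv /qmul /qscale /qsqnorm /=; congr Quat; field.
Qed.
Lemma qmulVr : {in qunit, right_inverse 1 qinv *%R}.
Proof.
move=> p; rewrite unfold_in /= /qunit -qsqnorm_eq0 => p0.
case: p p0 => a b c d; rewrite /qsqnorm /= => p0.
change (qmul (Quat a b c d) (qinv (Quat a b c d)) = Quat 1 0 0 0).
by rewrite /qinv /qmul /qscale /qsqnorm /=; congr Quat; field.
Qed.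
Lemma qunitP (p q : H) : q * p = 1 /\ p * q = 1 -> qunit p.
Proof.
by move=> [qp _]; apply/eqP => p0; move/eqP: qp; rewrite p0 mulr0 eq_sym oner_eq0.
Qed.
Lemma qinv_out : {in [predC qunit], qinv =1 id}.
Proof.
move=> p; rewrite inE unfold_in /= /qunit negbK => /eqP ->.
change (qinv (Quat 0 0 0 0) = Quat 0 0 0 0).
by rewrite /qinv /qscale /= !oppr0 !mulr0.
Qed.
HB.instance Definition _ :=
  GRing.NzRing_hasMulInverse.Build H qmulVl qmulVr qunitP qinv_out.

End QuatAlgebra.

Section QuatExponential.
Variable R : realType.
Local Notation H := (quat R).

(* General term of e^q; the series is summed component by component. *)
Definition qexp_coeff (q : H) (m : nat) : H := m`!%:R^-1 *: q ^+ m.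

Definition qexp (q : H) : H :=
  Quat (limn (series (fun m => qre (qexp_coeff q m))))
       (limn (series (fun m => qim (qexp_coeff q m))))
       (limn (series (fun m => qjm (qexp_coeff q m))))
       (limn (series (fun m => qkm (qexp_coeff q m)))).

Lemma qsqnormX (q : H) m : qsqnorm (q ^+ m) = qsqnorm q ^+ m.
Proof.
elim: m => [|m IHm].
  by rewrite !expr0 /qsqnorm /= expr1n !expr0n /= !addr0.
rewrite !exprS -IHm; move: (q ^+ m) => p.
case: q p {IHm} => a b c d [a' b' c' d'].
by rewrite /qsqnorm /=; ring.
Qed.

(* [qexp] is never the default value of a divergent limit. *)
Lemma is_cvg_qexp (q : H) (f : H -> R) :
    f = @qre R \/ f = @qim R \/ f = @qjm R \/ f = @qkm R ->
  cvgn (series (fun m => f (qexp_coeff q m))).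
Proof.
move=> fE; apply: normed_cvg.
apply: (@series_le_cvg _ _ (exp_coeff (Num.sqrt (qsqnorm q)))).
- by move=> m /=.
- by move=> m; apply: exp_coeff_ge0; exact: sqrtr_ge0.
- move=> m /=; rewrite /exp_coeff /=.
  have fZ : f (qexp_coeff q m) = (m`!%:R)^-1 * f (q ^+ m).
    by case: fE => [|[|[|]]] ->.
  rewrite fZ normrM ger0_norm ?invr_ge0// mulrC ler_wpM2r ?invr_ge0//.
  have n0 : 0 <= qsqnorm q by rewrite /qsqnorm !addr_ge0 ?sqr_ge0.
  have -> : Num.sqrt (qsqnorm q) ^+ m = Num.sqrt (qsqnorm (q ^+ m)).
    rewrite qsqnormX; elim: m {fZ} => [|m IH]; first by rewrite !expr0 sqrtr1.
    by rewrite !exprS sqrtrM // IH.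
  rewrite -sqrtr_sqr ler_wsqrtr // /qsqnorm.
  have := (sqr_ge0 (qre (q ^+ m)), sqr_ge0 (qim (q ^+ m)),
           sqr_ge0 (qjm (q ^+ m)), sqr_ge0 (qkm (q ^+ m))).
  by move=> [[[]]]; case: fE => [|[|[|]]] ->; lra.
- exact: is_cvg_series_exp_coeff.
Qed.

End QuatExponential.

Section QuatSystem.
Variables (R : realType) (n : nat).
Local Notation H := (quat R).
Implicit Types (A B : 'M[H]_n) (v : 'cV[H]_n) (x : R -> 'cV[H]_n).

(* [unitmx] and [invmx] are only available over commutative rings. *)
Definition mx_inverse A B : Prop := A *m B = 1%:M /\ B *m A = 1%:M.

Definition quat_diagonalizable A : Prop :=
  exists (P Pinv : 'M[H]_n) (d : 'rV[H]_n),
    mx_inverse P Pinv /\ A = P *m diag_mx d *m Pinv.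

(* v q, with the scalar acting on the right: the entries are v i 0 * q, whereas
   those of q *: v are q * v i 0. *)
Definition rscale v (q : H) : 'cV[H]_n := v *m (q%:M : 'M[H]_1).

Definition right_eigenpair A v (l : H) : Prop :=
  v != 0 /\ A *m v = rscale v l.

Definition right_indep (v : 'I_n -> 'cV[H]_n) : Prop :=
  forall q : 'I_n -> H,
    \sum_(j < n) rscale (v j) (q j) = 0 -> forall j, q j = 0.

Definition quat_is_derive (f : R -> H) (t : R) (d : H) : Prop :=
  [/\ is_derive t (1 : R) (fun s => qre (f s)) (qre d),
      is_derive t (1 : R) (fun s => qim (f s)) (qim d),
      is_derive t (1 : R) (fun s => qjm (f s)) (qjm d) &
      is_derive t (1 : R) (fun s => qkm (f s)) (qkm d)].

Definition is_solution A x : Prop :=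
  forall (t : R) (i : 'I_n),
    quat_is_derive (fun s => x s i 0) t ((A *m x t) i 0).

Definition is_ivp_solution A (t0 : R) (x0 : 'cV[H]_n) x : Prop :=
  is_solution A x /\ x t0 = x0.

Definition is_fundamental_matrix A (X : R -> 'M[H]_n) : Prop :=
  (forall j : 'I_n, is_solution A (fun t => col j (X t))) /\
  (forall q : 'I_n -> H,
     (forall t, \sum_(j < n) rscale (col j (X t)) (q j) = 0) ->
     forall j, q j = 0).

Definition gen_solution (v : 'I_n -> 'cV[H]_n) (l : 'I_n -> H)
    (q : 'I_n -> H) (t : R) : 'cV[H]_n :=
  \sum_(j < n) rscale (rscale (v j) (qexp (t *: l j))) (q j).

Definition Xr (v : 'I_n -> 'cV[H]_n) (l : 'I_n -> H) (t : R) : 'M[H]_n :=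
  \matrix_(i < n, j < n) rscale (v j) (qexp (t *: l j)) i 0.

End QuatSystem.

(* Main.v *)
Require Import Defs.
From HB Require Import structures.
From mathcomp Require Import all_boot all_order all_algebra.
From mathcomp Require Import all_classical all_reals all_analysis.
From mathcomp Require Import ring.
Set Implicit Arguments.
Unset Strict Implicit.
Unset Printing Implicit Defensive.
Import Order.TTheory GRing.Theory Num.Theory.
Import numFieldNormedType.Exports.
Local Open Scope classical_set_scope.
Local Open Scope ring_scope.

(** Left multiplication by an eigenvalue becomes, on the eigenbasis, a diagonal
    action: if V is the matrix of the eigenvectors and L the diagonal matrix of
    the eigenvalues, then A V = V L ([eigen_cols_mx]), so that X(t) = V e^{tL},
    which is the matrix [Xr], satisfies X' = A X ([mx_is_derive_Xr]).  Right
    multiplication by a constant vector preserves solutions.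

    The converse needs Y(t) = e^{-tL} V^{-1} to satisfy Y' = - Y A
    ([mx_is_derive_Xr_inv]).  For any solution x the product rule then gives
    (Y x)' = - Y A x + Y A x = 0, so Y x is a constant vector q
    ([Xr_inv_solution_cst]), and x = X q because Y(t) is the inverse of X(t)
    ([Xr_invP]).  Existence, uniqueness, the shape of the general solution and
    the formula X(t) X(t0)^{-1} x0 all follow from this identity
    ([solution_flow]).

    Two ingredients lie behind this.
    - Analysis: d/dt e^{tl} = l e^{tl} for a quaternion l
      ([quat_is_derive_qexp]), by termwise differentiation of the four real
      power series in t.  As l commutes with e^{tl}, the derivative of
      e^{tl} e^{-tl} vanishes, whence e^{tl} e^{-tl} = 1 ([qexpMVr]).
    - Algebra over a skew field: n right independent columns in H^n form an
      invertible matrix ([right_indep_invertible]).  Seen over the reals, the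
      matrix is an injective endomorphism of a space of dimension 4n, hence it
      is surjective; this gives a right inverse, and injectivity makes that
      inverse two-sided. *)

(** * Componentwise convergence and the quaternion exponential *)

Section QuatCalculus.
Variable R : realType.
Local Notation H := (quat R).
Implicit Types (p q l a b : H) (u : nat -> H) (f g : R -> H).

Lemma quatP p q :
  qre p = qre q -> qim p = qim q -> qjm p = qjm q -> qkm p = qkm q -> p = q.
Proof. by case: p q => [? ? ? ?] [? ? ? ?] /= -> -> -> ->. Qed.

Lemma qmulE p q : p * q = qmul p q. Proof. by []. Qed.

Definition quat_cvg u q : Prop :=
  [/\ qre (u n) @[n --> \oo] --> qre q, qim (u n) @[n --> \oo] --> qim q,
      qjm (u n) @[n --> \oo] --> qjm q & qkm (u n) @[n --> \oo] --> qkm q].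

Lemma quat_cvg_unique u p q : quat_cvg u p -> quat_cvg u q -> p = q.
Proof.
move=> [p0 p1 p2 p3] [q0 q1 q2 q3].
by apply: quatP; [apply: cvg_unique p0 q0|apply: cvg_unique p1 q1|
  apply: cvg_unique p2 q2|apply: cvg_unique p3 q3]; exact: norm_hausdorff.
Qed.

(** Each component of a u_n and of u_n a is a real linear combination of the
    components of u_n; this is the common form of those eight limits. *)
Lemma cvg_quat_form (v : nat -> R) (z : R) c0 c1 c2 c3 u q :
  quat_cvg u q ->
  (forall n, v n = c0 * qre (u n) + c1 * qim (u n) +
                   c2 * qjm (u n) + c3 * qkm (u n)) ->
  z = c0 * qre q + c1 * qim q + c2 * qjm q + c3 * qkm q ->
  v n @[n --> \oo] --> z.
Proof.
move=> [h0 h1 h2 h3] vE ->.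
rewrite (_ : v = (fun n => c0 * qre (u n)) \+ (fun n => c1 * qim (u n)) \+
  (fun n => c2 * qjm (u n)) \+ (fun n => c3 * qkm (u n))); last first.
  by apply/funext => n; rewrite vE.
have M (c : R) (w : nat -> R) (y : R) : w n @[n --> \oo] --> y ->
    c * w n @[n --> \oo] --> c * y.
  by move=> wy; apply: cvgM => //; exact: cvg_cst.
by apply: cvgD; [apply: cvgD; [apply: cvgD|]|]; exact: M.
Qed.

Lemma quat_cvgMl a u q : quat_cvg u q -> quat_cvg (fun n => a * u n) (a * q).
Proof.
move=> uq; split.
- by apply: (@cvg_quat_form _ _ (qre a) (- qim a) (- qjm a) (- qkm a) u q) => // *;
  rewrite qmulE /=; ring.
- by apply: (@cvg_quat_form _ _ (qim a) (qre a) (- qkm a) (qjm a) u q) => // *;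
  rewrite qmulE /=; ring.
- by apply: (@cvg_quat_form _ _ (qjm a) (qkm a) (qre a) (- qim a) u q) => // *;
  rewrite qmulE /=; ring.
- by apply: (@cvg_quat_form _ _ (qkm a) (- qjm a) (qim a) (qre a) u q) => // *;
  rewrite qmulE /=; ring.
Qed.

Lemma quat_cvgMr a u q : quat_cvg u q -> quat_cvg (fun n => u n * a) (q * a).
Proof.
move=> uq; split.
- by apply: (@cvg_quat_form _ _ (qre a) (- qim a) (- qjm a) (- qkm a) u q) => // *;
  rewrite qmulE /=; ring.
- by apply: (@cvg_quat_form _ _ (qim a) (qre a) (qkm a) (- qjm a) u q) => // *;
  rewrite qmulE /=; ring.
- by apply: (@cvg_quat_form _ _ (qjm a) (- qkm a) (qre a) (qim a) u q) => // *;
  rewrite qmulE /=; ring.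
- by apply: (@cvg_quat_form _ _ (qkm a) (qjm a) (- qim a) (qre a) u q) => // *;
  rewrite qmulE /=; ring.
Qed.

Lemma qre_is_linear : linear (@qre R : H -> R^o). Proof. by []. Qed.
Lemma qim_is_linear : linear (@qim R : H -> R^o). Proof. by []. Qed.
Lemma qjm_is_linear : linear (@qjm R : H -> R^o). Proof. by []. Qed.
Lemma qkm_is_linear : linear (@qkm R : H -> R^o). Proof. by []. Qed.
HB.instance Definition _ := GRing.isLinear.Build R H R^o _ _ qre_is_linear.
HB.instance Definition _ := GRing.isLinear.Build R H R^o _ _ qim_is_linear.
HB.instance Definition _ := GRing.isLinear.Build R H R^o _ _ qjm_is_linear.
HB.instance Definition _ := GRing.isLinear.Build R H R^o _ _ qkm_is_linear.

Lemma series_linear_form (c : {linear H -> R^o}) u :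
  series (fun m => c (u m)) = (fun n => c (\sum_(0 <= m < n) u m)).
Proof. by apply/funext => n; rewrite /series /= linear_sum. Qed.

Lemma quat_cvg_qexp q :
  quat_cvg (fun n => \sum_(0 <= m < n) qexp_coeff q m) (qexp q).
Proof.
split; rewrite -series_linear_form; apply: is_cvg_qexp; tauto.
Qed.

(** If a commutes with q it commutes with every partial sum of the series of
    e^q, and both one-sided multiplications by a are continuous. *)
Lemma qexp_comm a q : GRing.comm a q -> GRing.comm a (qexp q).
Proof.
move=> aq; have := quat_cvgMl a (quat_cvg_qexp q).
suff -> : (fun n => a * \sum_(0 <= m < n) qexp_coeff q m) =
          (fun n => (\sum_(0 <= m < n) qexp_coeff q m) * a).
  by move/quat_cvg_unique; apply; apply: quat_cvgMr; exact: quat_cvg_qexp.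
apply/funext => n; rewrite mulr_sumr mulr_suml; apply: eq_bigr => m _.
by rewrite /qexp_coeff -scalerAr (commrX m aq) scalerAl.
Qed.

Lemma qexp0 : qexp (0 : H) = 1.
Proof.
apply: (quat_cvg_unique (quat_cvg_qexp 0)).
have sum1 n : \sum_(0 <= m < n.+1) qexp_coeff (0 : H) m = 1.
  rewrite big_nat_recl// /qexp_coeff expr0 fact0 invr1 scale1r big1 ?addr0//.
  by move=> m _; rewrite expr0n scaler0.
by split; rewrite -(cvg_shiftS _) /=;
  under eq_cvg do rewrite sum1; exact: cvg_cst.
Qed.

(** * Differentiation of quaternion-valued functions *)

(** The components of a quaternion product are signed sums of four products of
    components; e0, ..., e3 stand for the signs. *)
Lemma is_derive_pairing (v : R -> R) (t dv e0 e1 e2 e3 : R)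
    (f0 f1 f2 f3 g0 g1 g2 g3 : R -> R) (a0 a1 a2 a3 b0 b1 b2 b3 : R) :
  is_derive t (1 : R) f0 a0 -> is_derive t (1 : R) f1 a1 ->
  is_derive t (1 : R) f2 a2 -> is_derive t (1 : R) f3 a3 ->
  is_derive t (1 : R) g0 b0 -> is_derive t (1 : R) g1 b1 ->
  is_derive t (1 : R) g2 b2 -> is_derive t (1 : R) g3 b3 ->
  (forall s, v s = e0 * (f0 s * g0 s) + e1 * (f1 s * g1 s) +
                   e2 * (f2 s * g2 s) + e3 * (f3 s * g3 s)) ->
  dv = e0 * (a0 * g0 t + f0 t * b0) + e1 * (a1 * g1 t + f1 t * b1) +
       e2 * (a2 * g2 t + f2 t * b2) + e3 * (a3 * g3 t + f3 t * b3) ->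
  is_derive t (1 : R) v dv.
Proof.
move=> F0 F1 F2 F3 G0 G1 G2 G3 vE ->.
rewrite (_ : v = e0 \*: (f0 * g0) + e1 \*: (f1 * g1) + e2 \*: (f2 * g2) +
                 e3 \*: (f3 * g3)); last by apply/funext => s; rewrite vE.
have M e (f g : R -> R) (a b : R) : is_derive t (1 : R) f a ->
    is_derive t (1 : R) g b ->
    is_derive t (1 : R) (e \*: (f * g)) (e * (a * g t + f t * b)).
  move=> df dg; apply: (is_derive_eq (is_deriveZ e (is_deriveM df dg))).
  change (e * (f t * b + g t * a) = e * (a * g t + f t * b)); ring.
have D0 := M e0 _ _ _ _ F0 G0; have D1 := M e1 _ _ _ _ F1 G1.
have D2 := M e2 _ _ _ _ F2 G2; have D3 := M e3 _ _ _ _ F3 G3.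
exact: (is_deriveD (is_deriveD (is_deriveD D0 D1) D2) D3).
Qed.

Lemma quat_is_deriveM f g t df dg :
  quat_is_derive f t df -> quat_is_derive g t dg ->
  quat_is_derive (fun s => f s * g s) t (df * g t + f t * dg).
Proof.
move=> [f0 f1 f2 f3] [g0 g1 g2 g3]; split.
- by apply: (@is_derive_pairing _ _ _ 1 (-1) (-1) (-1) _ _ _ _ _ _ _ _
    _ _ _ _ _ _ _ _ f0 f1 f2 f3 g0 g1 g2 g3) => *; rewrite !qmulE /=; ring.
- by apply: (@is_derive_pairing _ _ _ 1 1 1 (-1) _ _ _ _ _ _ _ _
    _ _ _ _ _ _ _ _ f0 f1 f2 f3 g1 g0 g3 g2) => *; rewrite !qmulE /=; ring.
- by apply: (@is_derive_pairing _ _ _ 1 (-1) 1 1 _ _ _ _ _ _ _ _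
    _ _ _ _ _ _ _ _ f0 f1 f2 f3 g2 g3 g0 g1) => *; rewrite !qmulE /=; ring.
- by apply: (@is_derive_pairing _ _ _ 1 1 (-1) 1 _ _ _ _ _ _ _ _
    _ _ _ _ _ _ _ _ f0 f1 f2 f3 g3 g2 g1 g0) => *; rewrite !qmulE /=; ring.
Qed.

Lemma quat_is_derive_cst q t : quat_is_derive (fun=> q) t 0.
Proof. by split; exact: is_derive_cst. Qed.

Lemma quat_is_deriveD f g t df dg :
  quat_is_derive f t df -> quat_is_derive g t dg ->
  quat_is_derive (fun s => f s + g s) t (df + dg).
Proof. by move=> [? ? ? ?] [? ? ? ?]; split; exact: is_deriveD. Qed.

Lemma quat_is_derive0_cst f : (forall t, quat_is_derive f t 0) ->
  forall s t, f s = f t.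
Proof.
move=> f0 s t; apply: quatP;
  [apply: (@is_derive_0_is_cst R (@qre R \o f))
  |apply: (@is_derive_0_is_cst R (@qim R \o f))
  |apply: (@is_derive_0_is_cst R (@qjm R \o f))
  |apply: (@is_derive_0_is_cst R (@qkm R \o f))] => r; by case: (f0 r).
Qed.

Lemma qexp_coeffZ (s : R) l m : qexp_coeff (s *: l) m = s ^+ m *: qexp_coeff l m.
Proof. by rewrite /qexp_coeff exprZn !scalerA mulrC. Qed.

Lemma qexp_coeffS l m : m.+1%:R *: qexp_coeff l m.+1 = l * qexp_coeff l m.
Proof.
rewrite /qexp_coeff scalerA factS natrM invfM mulVKf ?pnatr_eq0//.
by rewrite exprS scalerAr.
Qed.

(** For a continuous real linear form c, the function s |-> c (e^{sl}) is the sum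
    of the power series with coefficients c (l^m / m!).  Its first and second
    formal derivatives have coefficients c (l l^m / m!) and c (l l l^m / m!),
    so they are series of the same kind, with a constant factor a in front of
    l^m / m!.  All these series converge everywhere, which is what termwise
    differentiation requires. *)
Lemma is_derive_qexp_form (c : {linear H -> R^o}) l t :
  (forall u q, quat_cvg u q -> (c (u n) : R) @[n --> \oo] --> (c q : R)) ->
  is_derive t (1 : R) (fun s => c (qexp (s *: l)) : R) (c (l * qexp (t *: l))).
Proof.
move=> c_cts.
pose b a m : R := c (a * qexp_coeff l m).
have b_cvg a s : pseries (b a) s @ \oo --> (c (a * qexp (s *: l)) : R).
  rewrite /pseries (_ : (fun i => _) = (fun m => c (a * qexp_coeff (s *: l) m))).
    rewrite (series_linear_form c (fun m => a * qexp_coeff (s *: l) m)).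
    apply: c_cts; rewrite (_ : (fun n => _) =
      (fun n => a * \sum_(0 <= m < n) qexp_coeff (s *: l) m)).
      by apply: quat_cvgMl; exact: quat_cvg_qexp.
    by apply/funext => n; rewrite mulr_sumr.
  by apply/funext => m; rewrite qexp_coeffZ -scalerAr linearZ /= mulrC.
have b_diffs a : pseries_diffs (b a) = b (a * l).
  apply/funext => m; rewrite /pseries_diffs /b -mulrA -qexp_coeffS.
  by rewrite -[in RHS]scalerAr linearZ.
have lim_b a s : limn (pseries (b a) s) = c (a * qexp (s *: l)).
  by apply: cvg_lim (b_cvg a s); exact: norm_hausdorff.
rewrite (_ : (fun s => _) = (fun s => limn (pseries (b 1) s))); last first.
  by apply/funext => s; rewrite lim_b mul1r.
have -> : c (l * qexp (t *: l)) = limn (pseries (pseries_diffs (b 1)) t).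
  by rewrite b_diffs mul1r lim_b.
apply: (@pseries_snd_diffs _ _ (`|t| + 1)).
- by apply/cvg_ex; eexists; exact: b_cvg.
- by rewrite b_diffs; apply/cvg_ex; eexists; exact: b_cvg.
- by rewrite !b_diffs; apply/cvg_ex; eexists; exact: b_cvg.
- by rewrite [ltRHS]ger0_norm ?ltrDl ?addr_ge0.
Qed.

Lemma quat_is_derive_qexp l t :
  quat_is_derive (fun s => qexp (s *: l)) t (l * qexp (t *: l)).
Proof.
by split; [apply: (is_derive_qexp_form (c := @qre R))
          |apply: (is_derive_qexp_form (c := @qim R))
          |apply: (is_derive_qexp_form (c := @qjm R))
          |apply: (is_derive_qexp_form (c := @qkm R))] => u q [].
Qed.

Lemma qexpZ_comm l t : l * qexp (t *: l) = qexp (t *: l) * l.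
Proof. by apply: qexp_comm; rewrite /GRing.comm -scalerAl -scalerAr. Qed.

(** The derivative l e^{tl} e^{-tl} - e^{tl} l e^{-tl} vanishes since l commutes
    with e^{tl}, so the product keeps its value at t = 0. *)
Lemma qexpMVr l t : qexp (t *: l) * qexp (t *: - l) = 1.
Proof.
pose G s := qexp (s *: l) * qexp (s *: - l).
have G0 s : quat_is_derive G s 0.
  have := quat_is_deriveM (quat_is_derive_qexp l s) (quat_is_derive_qexp (- l) s).
  have -> // : l * qexp (s *: l) * qexp (s *: - l) +
            qexp (s *: l) * (- l * qexp (s *: - l)) = 0.
  by rewrite (qexpZ_comm l s) -mulrA mulNr mulrN subrr.
by have := quat_is_derive0_cst G0 t 0; rewrite /G !scale0r qexp0 mulr1.
Qed.

End QuatCalculus.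

(** * Right independent columns over the quaternions *)

Section QuatLinearAlgebra.
Variables (R : realType) (n : nat).
Local Notation H := (quat R).
Local Notation realvec := {ffun 'I_n -> R^o * R^o * R^o * R^o}%type.

Section Realification.
Variable V : 'M[H]_n.

(** Quaternion matrices carry a module structure over the quaternions only, so
    H^n is transported to a real vector space of dimension 4n, where an
    injective endomorphism is known to be surjective. *)
Definition quat_of_real (x : realvec) : 'cV[H]_n :=
  \col_j tuple_quat (x j : R * R * R * R).
Definition real_of_quat (u : 'cV[H]_n) : realvec :=
  [ffun i => quat_tuple (u i 0)].

Lemma real_of_quatK : cancel real_of_quat quat_of_real.
Proof. by move=> u; apply/colP => i; rewrite mxE ffunE quat_tupleK. Qed.

Lemma quat_of_realK : cancel quat_of_real real_of_quat.
Proof.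
move=> x; apply/ffunP => i; rewrite ffunE mxE.
by case: (x i) => [[[? ?] ?] ?].
Qed.

Definition real_mulmx (x : realvec) : realvec :=
  real_of_quat (V *m quat_of_real x).

Lemma real_mulmx_is_linear : linear real_mulmx.
Proof.
move=> a x y; apply/ffunP => i; rewrite !ffunE !mxE.
have -> : \sum_j V i j * quat_of_real (a *: x + y) j 0 =
    a *: \sum_j V i j * quat_of_real x j 0 + \sum_j V i j * quat_of_real y j 0.
  rewrite scaler_sumr -big_split; apply: eq_bigr => j _ /=.
  rewrite scalerAr -mulrDr; congr (_ * _); rewrite !mxE !ffunE.
  by case: (x j) (y j) => [[[? ?] ?] ?] [[[? ?] ?] ?].
by [].
Qed.
HB.instance Definition _ :=
  GRing.isLinear.Build R realvec realvec _ _ real_mulmx_is_linear.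

Lemma mulmx_inj_surj : (forall u : 'cV[H]_n, V *m u = 0 -> u = 0) ->
  forall w : 'cV[H]_n, exists u, V *m u = w.
Proof.
move=> Vinj w; have ker0 : lker (linfun real_mulmx) == 0%VS.
  apply/lker0P => x y; rewrite !lfunE /= => /(can_inj real_of_quatK) Vxy.
  apply/(can_inj quat_of_realK)/eqP; rewrite -subr_eq0; apply/eqP/Vinj.
  by rewrite mulmxBr Vxy subrr.
have := lker0_lfunVK ker0 (real_of_quat w); rewrite lfunE /=.
move/(can_inj real_of_quatK) => Vu; by eexists; exact: Vu.
Qed.

End Realification.

Lemma col_mulmx (P Q : 'M[H]_n) j : col j (P *m Q) = P *m col j Q.
Proof. by rewrite !colE mulmxA. Qed.

Definition cols_mx (v : 'I_n -> 'cV[H]_n) : 'M[H]_n := \matrix_(i, j) v j i 0.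

Lemma rscaleE (v : 'cV[H]_n) (q : H) i : rscale v q i 0 = v i 0 * q.
Proof. by rewrite mxE big_ord1 mxE eqxx. Qed.

Lemma cols_mx_mulE (v : 'I_n -> 'cV[H]_n) (q : 'I_n -> H) :
  \sum_(j < n) rscale (v j) (q j) = cols_mx v *m (\col_j q j).
Proof.
apply/colP => i; rewrite summxE mxE.
by apply: eq_bigr => j _; rewrite rscaleE !mxE.
Qed.

Lemma right_indep_mulmx (v : 'I_n -> 'cV[H]_n) :
  right_indep v <-> forall u : 'cV[H]_n, cols_mx v *m u = 0 -> u = 0.
Proof.
split=> [ind u vu|inj q].
  apply/colP => j; rewrite mxE; apply: (ind (fun j => u j 0)).
  by rewrite cols_mx_mulE -[RHS]vu; congr mulmx; apply/colP => k; rewrite mxE.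
by rewrite cols_mx_mulE => /inj/colP q0 j; have := q0 j; rewrite !mxE.
Qed.

(** Surjectivity yields W with V W = 1; then V (W V - 1) = 0, and injectivity of
    V, applied to each column of W V - 1, gives W V = 1. *)
Lemma right_indep_invertible (v : 'I_n -> 'cV[H]_n) :
  right_indep v -> exists W, mx_inverse (cols_mx v) W.
Proof.
move=> /right_indep_mulmx inj.
have [w wP] := choice (fun j => mulmx_inj_surj inj (delta_mx j 0)).
have VW : cols_mx v *m cols_mx w = 1%:M.
  apply/matrixP => i j; have /colP/(_ i) := wP j.
  by rewrite !mxE eqxx andbT => <-; apply: eq_bigr => k _; rewrite !mxE.
exists (cols_mx w); split=> //; apply/eqP; rewrite -subr_eq0; apply/eqP.
apply/matrixP => i j.
have /inj/colP/(_ i) : cols_mx v *m col j (cols_mx w *m cols_mx v - 1%:M) = 0.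
  by rewrite -col_mulmx mulmxBr mulmxA VW mul1mx mulmx1 subrr col0.
by rewrite !mxE.
Qed.

Lemma mx_inverseM (P Q P' Q' : 'M[H]_n) :
  mx_inverse P Q -> mx_inverse P' Q' -> mx_inverse (P *m P') (Q' *m Q).
Proof.
move=> [PQ QP] [PQ' QP']; split; rewrite mulmxA.
  by rewrite -[P *m _ *m _]mulmxA PQ' mulmx1.
by rewrite -[Q' *m _ *m _]mulmxA QP mulmx1.
Qed.

Lemma cols_mx_col (P : 'M[H]_n) : cols_mx (fun j => col j P) = P.
Proof. by apply/matrixP => i j; rewrite !mxE. Qed.

Lemma mx_inverse_col_neq0 (P Q : 'M[H]_n) j : mx_inverse P Q -> col j P != 0.
Proof.
move=> [_ QP]; apply/eqP => Pj0.
have /colP/(_ j) : col j (Q *m P) = 0 by rewrite col_mulmx Pj0 mulmx0.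
by rewrite QP !mxE eqxx => /eqP; rewrite oner_eq0.
Qed.

End QuatLinearAlgebra.

(** * Differentiation of quaternion matrices *)

Section QuatMatrixCalculus.
Variable R : realType.
Local Notation H := (quat R).

Definition mx_is_derive m p (X : R -> 'M[H]_(m, p)) (t : R) (D : 'M[H]_(m, p)) :=
  forall i j, quat_is_derive (fun s => X s i j) t (D i j).

Lemma mx_is_derive_cst m p (M : 'M[H]_(m, p)) t : mx_is_derive (fun=> M) t 0.
Proof. by move=> i j; rewrite mxE; exact: quat_is_derive_cst. Qed.

Lemma mx_is_deriveM m p r (X : R -> 'M[H]_(m, p)) (Y : R -> 'M[H]_(p, r))
    t DX DY :
  mx_is_derive X t DX -> mx_is_derive Y t DY ->
  mx_is_derive (fun s => X s *m Y s) t (DX *m Y t + X t *m DY).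
Proof.
move=> dX dY i j; rewrite !mxE -big_split.
rewrite (_ : (fun s => _) = (fun s => \sum_k X s i k * Y s k j)); last first.
  by apply/funext => s; rewrite mxE.
rewrite /index_enum; elim: (Finite.enum _) => [|k ks IH].
  rewrite big_nil (_ : (fun s => _) = fun=> 0); first exact: quat_is_derive_cst.
  by apply/funext => s; rewrite big_nil.
rewrite big_cons (_ : (fun s => _) =
  fun s => X s i k * Y s k j + \sum_(k <- ks) X s i k * Y s k j).
  exact: quat_is_deriveD (quat_is_deriveM (dX i k) (dY k j)) IH.
by apply/funext => s; rewrite big_cons.
Qed.

Lemma mx_is_deriveMl m p r (M : 'M[H]_(m, p)) (Y : R -> 'M[H]_(p, r)) t DY :
  mx_is_derive Y t DY -> mx_is_derive (fun s => M *m Y s) t (M *m DY).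
Proof.
move=> dY; have := mx_is_deriveM (mx_is_derive_cst M t) dY.
by rewrite mul0mx add0r.
Qed.

Lemma mx_is_deriveMr m p r (X : R -> 'M[H]_(m, p)) (M : 'M[H]_(p, r)) t DX :
  mx_is_derive X t DX -> mx_is_derive (fun s => X s *m M) t (DX *m M).
Proof.
move=> dX; have := mx_is_deriveM dX (mx_is_derive_cst M t).
by rewrite mulmx0 addr0.
Qed.

Lemma mx_is_derive0_cst m p (X : R -> 'M[H]_(m, p)) :
  (forall t, mx_is_derive X t 0) -> forall s t, X s = X t.
Proof.
move=> X0 s t; apply/matrixP => i j.
apply: (quat_is_derive0_cst (f := fun s => X s i j)).
by move=> r; have := X0 r i j; rewrite mxE.
Qed.

Lemma is_solutionP n (A : 'M[H]_n) x :
  is_solution A x <-> forall t, mx_is_derive x t (A *m x t).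
Proof. by split=> sx t i => [j|]; [rewrite (ord1 j)|]; exact: sx. Qed.

Lemma mx_is_derive_diag n (d : R -> 'rV[H]_n) (t : R) (dd : 'rV[H]_n) :
  mx_is_derive d t dd ->
  mx_is_derive (fun s => diag_mx (d s)) t (diag_mx dd).
Proof.
move=> d' i j; rewrite mxE (_ : (fun s => _) = (fun s => d s 0 i *+ (i == j))).
  by case: (i == j); [exact: d'|exact: quat_is_derive_cst].
by apply/funext => s; rewrite mxE.
Qed.

Section DiagonalExponential.
Variables (n : nat) (l : 'I_n -> H).

Definition diag_qexp (t : R) : 'M[H]_n := diag_mx (\row_j qexp (t *: l j)).

Lemma mx_is_derive_diag_qexp t :
  mx_is_derive diag_qexp t (diag_mx (\row_j l j) *m diag_qexp t).
Proof.
rewrite mulmx_diag; apply: mx_is_derive_diag => i j.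
have -> : (fun s : R => (\row_k qexp (s *: l k)) i j) =
          (fun s => qexp (s *: l j)) by apply/funext => s; rewrite mxE.
have -> : (\row_k ((\row_k0 l k0) 0 k * (\row_k0 qexp (t *: l k0)) 0 k)) i j =
          l j * qexp (t *: l j) by rewrite mxE; congr (_ * _); rewrite mxE.
exact: quat_is_derive_qexp.
Qed.

Lemma diag_qexp_comm t :
  diag_mx (\row_j l j) *m diag_qexp t = diag_qexp t *m diag_mx (\row_j l j).
Proof.
rewrite !mulmx_diag; congr diag_mx; apply/rowP => j.
rewrite [LHS]mxE [RHS]mxE [(\row_k l k) 0 j]mxE [(\row_k qexp _) 0 j]mxE.
exact: qexpZ_comm.
Qed.

End DiagonalExponential.

Lemma diag_qexpMVr n (l : 'I_n -> H) t :
  diag_qexp l t *m diag_qexp (fun j => - l j) t = 1%:M.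
Proof.
rewrite mulmx_diag -diag_const_mx; congr diag_mx; apply/rowP => j.
by rewrite [LHS]mxE [RHS]mxE -(qexpMVr (l j) t); congr (_ * _); rewrite mxE.
Qed.

Lemma diag_qexpMVl n (l : 'I_n -> H) t :
  diag_qexp (fun j => - l j) t *m diag_qexp l t = 1%:M.
Proof.
have := diag_qexpMVr (fun j => - l j) t.
by rewrite (_ : (fun j => - - l j) = l)//; apply/funext => j; rewrite opprK.
Qed.

End QuatMatrixCalculus.

(** * Solutions of the diagonalizable system *)

Section QuatSystemSolutions.
Variables (R : realType) (n : nat) (A : 'M[quat R]_n).
Variables (v : 'I_n -> 'cV[quat R]_n) (l : 'I_n -> quat R).
Local Notation H := (quat R).
Local Notation V := (cols_mx v).

Lemma XrE t : Xr v l t = V *m diag_qexp l t.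
Proof.
apply/matrixP => i j; rewrite mxE rscaleE mul_mx_diag mxE; congr (_ * _).
all: by rewrite mxE.
Qed.

Lemma gen_solutionE q t : gen_solution v l q t = Xr v l t *m \col_j q j.
Proof.
exact: cols_mx_mulE.
Qed.

Hypothesis Av : forall j, right_eigenpair A (v j) (l j).

Lemma eigen_cols_mx : A *m V = V *m diag_mx (\row_j l j).
Proof.
apply/matrixP => i j; rewrite mul_mx_diag mxE [in RHS]mxE.
have [_ /colP/(_ i)] := Av j; rewrite rscaleE !mxE => <-.
by apply: eq_bigr => k _; rewrite mxE.
Qed.

Lemma mx_is_derive_Xr t : mx_is_derive (Xr v l) t (A *m Xr v l t).
Proof.
rewrite XrE mulmxA eigen_cols_mx -mulmxA.
rewrite (_ : Xr v l = fun s => V *m diag_qexp l s); last exact/funext/XrE.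
by apply: mx_is_deriveMl; exact: mx_is_derive_diag_qexp.
Qed.

Lemma Xr_solution (c : 'cV[H]_n) : is_solution A (fun t => Xr v l t *m c).
Proof.
apply/is_solutionP => t; rewrite mulmxA.
by apply: mx_is_deriveMr; exact: mx_is_derive_Xr.
Qed.

Variable W : 'M[H]_n.
Hypothesis VW : mx_inverse V W.

Definition Xr_inv t : 'M[H]_n := diag_qexp (fun j => - l j) t *m W.

Lemma Xr_invP t : mx_inverse (Xr v l t) (Xr_inv t).
Proof.
rewrite XrE; apply: mx_inverseM VW _.
by split; [exact: diag_qexpMVr|exact: diag_qexpMVl].
Qed.

(** From A V = V L follows V^{-1} A = L V^{-1}.  Since e^{-tL} commutes with L,
    the factor - L produced by differentiation moves past the exponential and
    becomes - A on the right. *)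
Lemma mx_is_derive_Xr_inv t : mx_is_derive Xr_inv t (- (Xr_inv t *m A)).
Proof.
have [VW1 WV1] := VW; set M := diag_mx (\row_j - l j).
have WA : W *m A = - M *m W.
  have -> : - M = diag_mx (\row_j l j).
    by apply/matrixP => i j; rewrite !mxE mulNrn opprK.
  by rewrite -[LHS]mulmx1 -VW1 mulmxA -[W *m A *m V]mulmxA eigen_cols_mx
             [W *m (V *m _)]mulmxA WV1 mul1mx.
have alg (E : 'M[H]_n) : M *m E = E *m M -> - (E *m W *m A) = M *m E *m W.
  by move=> ->; rewrite -mulmxA WA mulNmx mulmxN opprK mulmxA.
rewrite [X in mx_is_derive _ _ X](alg _ (diag_qexp_comm (fun j => - l j) t)).
by apply: mx_is_deriveMr; exact: mx_is_derive_diag_qexp.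
Qed.

Lemma Xr_inv_solution_cst x : is_solution A x ->
  forall s t, Xr_inv s *m x s = Xr_inv t *m x t.
Proof.
move=> /is_solutionP sx.
apply: (mx_is_derive0_cst (X := fun s => Xr_inv s *m x s)) => t.
have cancel (E : 'M[H]_n) (y : 'cV[H]_n) : - (E *m A) *m y + E *m (A *m y) = 0.
  by rewrite mulNmx mulmxA addNr.
rewrite -[X in mx_is_derive _ _ X](cancel (Xr_inv t) (x t)).
exact: mx_is_deriveM (mx_is_derive_Xr_inv t) (sx t).
Qed.

Lemma solution_flow x : is_solution A x ->
  forall t0 t, x t = Xr v l t *m Xr_inv t0 *m x t0.
Proof.
move=> sx t0 t; rewrite -mulmxA (Xr_inv_solution_cst sx t0 t) mulmxA.
by have [-> _] := Xr_invP t; rewrite mul1mx.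
Qed.

End QuatSystemSolutions.

(** The columns of P in A = P D P^{-1}: reading A P = P D column by column shows
    that they are eigenvectors, the diagonal entries acting from the right. *)
Lemma diagonalizable_eigenbasis (R : realType) (n : nat) (A : 'M[quat R]_n) :
  quat_diagonalizable A ->
  exists (v : 'I_n -> 'cV[quat R]_n) (l : 'I_n -> quat R),
    (forall j, right_eigenpair A (v j) (l j)) /\ right_indep v.
Proof.
move=> [P [Q [d [PQ ->]]]]; have [_ QP1] := PQ.
exists (fun j => col j P), (fun j => d 0 j); split=> [j|].
  split; first exact: mx_inverse_col_neq0 PQ.
  rewrite -col_mulmx -mulmxA QP1 mulmx1.
  by apply/colP => i; rewrite rscaleE mul_mx_diag !mxE.
apply/right_indep_mulmx => u; rewrite cols_mx_col => Pu.
by rewrite -[u]mul1mx -QP1 -mulmxA Pu mulmx0.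
Qed.

Theorem theorem3p11 (R : realType) (n : nat) (A : 'M[quat R]_n)
    (hA : quat_diagonalizable A) :
  (exists (v : 'I_n -> 'cV[quat R]_n) (l : 'I_n -> quat R),
     (forall j, right_eigenpair A (v j) (l j)) /\ right_indep v) /\
  (forall (v : 'I_n -> 'cV[quat R]_n) (l : 'I_n -> quat R),
     (forall j, right_eigenpair A (v j) (l j)) -> right_indep v ->
     [/\ (* general solution *)
         forall x : R -> 'cV[quat R]_n,
           is_solution A x <->
           exists q : 'I_n -> quat R, forall t, x t = gen_solution v l q t,
         is_fundamental_matrix A (Xr v l) &
         forall (t0 : R) (x0 : 'cV[quat R]_n),
           exists x : R -> 'cV[quat R]_n,
             [/\ unique (is_ivp_solution A t0 x0) x,
                 exists q : 'I_n -> quat R, x0 = gen_solution v l q t0,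
                 forall q : 'I_n -> quat R,
                   (forall t, x t = gen_solution v l q t) <->
                   x0 = gen_solution v l q t0 &
                 exists Xinv : 'M[quat R]_n,
                   mx_inverse (Xr v l t0) Xinv /\
                   forall t, x t = Xr v l t *m Xinv *m x0]]).
Proof.
split; first exact: diagonalizable_eigenbasis.
move=> v l Av /right_indep_invertible[W VW].
have inv t := Xr_invP l VW t; have flow := solution_flow Av VW.
have col_eta (c : 'cV[quat R]_n) : \col_j c j 0 = c.
  by apply/colP => j; rewrite mxE.
split=> [x||t0 x0].
- split=> [sx|[q xq]].
    exists (fun j => (Xr_inv l W 0 *m x 0) j 0) => t.
    by rewrite gen_solutionE col_eta mulmxA; exact: flow.
  rewrite (_ : x = fun t => Xr v l t *m \col_j q j); first exact: Xr_solution.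
  by apply/funext => t; rewrite xq gen_solutionE.
- split=> [j|q q0 j].
    rewrite (_ : (fun t => _) = fun t => Xr v l t *m delta_mx j 0).
      exact: Xr_solution.
    by apply/funext => t; rewrite colE.
  have [_ inv0] := inv 0.
  have qE : \col_j q j = 0.
    have Xq := q0 0; rewrite cols_mx_mulE cols_mx_col in Xq.
    by rewrite -[LHS]mul1mx -inv0 -mulmxA Xq mulmx0.
  by have /colP/(_ j) := qE; rewrite !mxE.
- have [invr invl] := inv t0.
  exists (fun t => Xr v l t *m (Xr_inv l W t0 *m x0)); split.
  + split.
      by split; [exact: Xr_solution|rewrite mulmxA invr mul1mx].
    move=> y [sy yt0]; apply/funext => t.
    by rewrite mulmxA -yt0; exact/esym/flow.
  + exists (fun j => (Xr_inv l W t0 *m x0) j 0).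
    by rewrite gen_solutionE col_eta mulmxA invr mul1mx.
  + move=> q; split=> [/(_ t0)|x0q t]; rewrite gen_solutionE.
      by rewrite mulmxA invr mul1mx.
    by rewrite x0q gen_solutionE [_ *m (Xr v l t0 *m _)]mulmxA invl mul1mx.
  + by exists (Xr_inv l W t0); split=> // t; rewrite mulmxA.
Qed.
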